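(* Let $\mathbb{H}/\mathbb{H}'$ be a one-parameter planar homothetic hyperbolic motion, given by $\mathbf{x}'=(h\mathbf{x}-\mathbf{u})e^{j\varphi}$, with $\dot h^2-h^2\dot\varphi^2\neq0$ for all $t$, and let $P$ be its pole point, represented in $\mathbb{H}$ by $\mathbf{p}$. At every $t$ at which $\ddot h+h\dot\varphi^2\neq\mp(2\dot h\dot\varphi+h\ddot\varphi)$ (i.e. neither sign gives equality), the acceleration pole point $Q=(q_1,q_2)\in\mathbb{H}$ (the point at which the sliding acceleration $\mathbf{b}_f$ vanishes) is the hyperbolic number $$\mathbf{q}=\mathbf{p}+\frac{\dot{\mathbf{p}}\,(\dot h+jh\dot\varphi)}{\ddot h+h\dot\varphi^2+j(2\dot h\dot\varphi+h\ddot\varphi)} .$$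
   Context: Hyperbolic numbers: $\mathbb{R}[j]=\{x+jy: x,y\in\mathbb{R}\}$ with $j^2=1$ ($j\neq\pm1$), a commutative ring; $e^{j\varphi}=\cosh\varphi+j\sinh\varphi$ for $\varphi\in\mathbb{R}$. A hyperbolic number $x+jy$ is invertible iff $x^2\ne y^2$; quotients are products with inverses. The point $(q_1,q_2)$ is identified with $q_1+jq_2$. One-parameter planar homothetic hyperbolic motion $\mathbb{H}/\mathbb{H}'$: $\mathbb{H}$ (moving) and $\mathbb{H}'$ (fixed) are two copies of the plane of hyperbolic numbers. Let $t$ range over a real interval containing $0$, and let $h,\varphi$ (real valued) and $\mathbf{u}=u_1+ju_2$ (hyperbolic-number valued) be $C^\infty$ functions of $t$, with $h$ (the homothetic scale) non-constant, $\dot\varphi(t)\neq0$ for all $t$, and the two coordinate systems coincident at $t=0$. A point represented in $\mathbb{H}$ by $\mathbf{x}$ is represented in $\mathbb{H}'$ at time $t$ by $\mathbf{x}'=(h\mathbf{x}-\mathbf{u})e^{j\varphi}$. Dots denote $d/dt$. The pole point $P$ is represented in $\mathbb{H}$ by $\mathbf{p}=\dfrac{\dot{\mathbf{u}}+j\dot\varphi\mathbf{u}}{\dot h+jh\dot\varphi}$. The sliding acceleration at the point $\mathbf{x}$ of $\mathbb{H}$ is $$\mathbf{b}_f=(\mathbf{x}-\mathbf{p})\left[\ddot h+h\dot\varphi^2+j(2\dot h\dot\varphi+h\ddot\varphi)\right]e^{j\varphi}-\dot{\mathbf{p}}(\dot h+jh\dot\varphi)e^{j\varphi}.$$ The acceleration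 pole at time $t$ is the point $\mathbf{x}=\mathbf{q}$ of $\mathbb{H}$ for which $\mathbf{b}_f=0$. *)

(* Defs.v *)
From HB Require Import structures.
From mathcomp Require Import all_boot all_order all_algebra.
From mathcomp Require Import ring.
From mathcomp Require Import all_classical all_reals all_analysis.
Import Order.TTheory GRing.Theory Num.Theory.
Import numFieldNormedType.Exports.

Set Implicit Arguments.
Unset Strict Implicit.
Unset Printing Implicit Defensive.

Local Open Scope classical_set_scope.
Local Open Scope ring_scope.

Declare Scope hyp_scope.
Delimit Scope hyp_scope with H.

(* Own record rather than R * R: the latter already carries the componentwise
   product. *)
Record hyperbolic (R : Type) : Type := Hyp { hre : R; him : R }.

Notation "x +j* y" := (Hyp x y) (at level 40, left associativity) : hyp_scope.
Notation "x %:H" := (Hyp x 0) (at level 1, format "x %:H") : ring_scope.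

Section HypChoice.

Definition hyp_pair (R : Type) (x : hyperbolic R) := (hre x, him x).
Definition pair_hyp (R : Type) (x : R * R) := Hyp x.1 x.2.

Lemma hyp_pairK (R : Type) : cancel (@hyp_pair R) (@pair_hyp R).
Proof. by case. Qed.

End HypChoice.

HB.instance Definition _ (R : eqType) :=
  Equality.copy (hyperbolic R) (can_type (@hyp_pairK R)).
HB.instance Definition _ (R : choiceType) :=
  Choice.copy (hyperbolic R) (can_type (@hyp_pairK R)).

Section HypRing.
Local Open Scope hyp_scope.
Variable R : fieldType.
Implicit Types x y z : hyperbolic R.

Definition addh x y := (hre x + hre y) +j* (him x + him y).
Definition opph x := (- hre x) +j* (- him x).
Definition mulh x y :=
  (hre x * hre y + him x * him y) +j* (hre x * him y + him x * hre y).

Lemma addhA : associative addh.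
Proof. by move=> [a b] [c d] [e f]; rewrite /addh /= !addrA. Qed.

Lemma addhC : commutative addh.
Proof. by move=> [a b] [c d]; rewrite /addh /= addrC [b + d]addrC. Qed.

Lemma add0h : left_id (0%:H : hyperbolic R) addh.
Proof. by move=> [a b]; rewrite /addh /= !add0r. Qed.

Lemma addNh : left_inverse (0%:H : hyperbolic R) opph addh.
Proof. by move=> [a b]; rewrite /addh /= !addNr. Qed.

HB.instance Definition _ :=
  GRing.isZmodule.Build (hyperbolic R) addhA addhC add0h addNh.

Lemma mulhA : associative mulh.
Proof. by move=> [a b] [c d] [e f]; rewrite /mulh /=; congr Hyp; ring. Qed.

Lemma mulhC : commutative mulh.
Proof. by move=> [a b] [c d]; rewrite /mulh /=; congr Hyp; ring. Qed.

Lemma mul1h : left_id (1%:H : hyperbolic R) mulh.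
Proof. by move=> [a b]; rewrite /mulh /=; congr Hyp; ring. Qed.

Lemma mulhDl : left_distributive mulh addh.
Proof. by move=> [a b] [c d] [e f]; rewrite /mulh /addh /=; congr Hyp; ring. Qed.

Lemma oneh_neq0 : (1%:H : hyperbolic R) != 0.
Proof. by apply/eqP => -[] /eqP; rewrite oner_eq0. Qed.

HB.instance Definition _ := GRing.Zmodule_isComNzRing.Build (hyperbolic R)
  mulhA mulhC mul1h mulhDl oneh_neq0.

Definition unith : {pred hyperbolic R} :=
  [pred x | hre x ^+ 2 != him x ^+ 2].

(* On non-units the ring inverse is, by the convention of unitRingType, the
   identity. *)
Definition invh x :=
  if x \in unith then
    (hre x / (hre x ^+ 2 - him x ^+ 2)) +j*
    (- him x / (hre x ^+ 2 - him x ^+ 2))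
  else x.

Lemma mulVh : {in unith, left_inverse 1 invh *%R}.
Proof.
move=> [a b] Ux; rewrite /invh Ux.
move: Ux; rewrite inE /= -subr_eq0 => ab0.
by rewrite -[LHS]/(mulh _ _) /mulh /=; congr Hyp; field.
Qed.

Lemma unithPl x y : y * x = 1 -> unith x.
Proof.
case: x y => [a b] [c d] yx1; have [e1 e2] : mulh (c +j* d) (a +j* b) = 1%:H := yx1.
apply/eqP => /= eab; have /eqP := oner_neq0 R; apply.
have -> : (1 : R) = (c * a + d * b) ^+ 2 - (c * b + d * a) ^+ 2.
  by rewrite e1 e2; ring.
have -> : (c * a + d * b) ^+ 2 - (c * b + d * a) ^+ 2 =
          (c ^+ 2 - d ^+ 2) * (a ^+ 2 - b ^+ 2) by ring.
by rewrite eab subrr mulr0.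
Qed.

Lemma invh_out : {in [predC unith], invh =1 id}.
Proof. by move=> x; rewrite inE /= /invh => /negbTE ->. Qed.

HB.instance Definition _ := GRing.ComNzRing_hasMulInverse.Build (hyperbolic R)
  mulVh unithPl invh_out.

Definition hj : hyperbolic R := 0 +j* 1.

Lemma hj_sqr : hj ^+ 2 = 1.
Proof.
by rewrite expr2 -[LHS]/(mulh _ _) /mulh /=; congr Hyp; ring.
Qed.

Lemma hypE (a b : R) : Hyp a b = a%:H + hj * b%:H.
Proof.
by rewrite -[RHS]/(addh _ (mulh _ _)) /addh /mulh /=; congr Hyp; ring.
Qed.

End HypRing.

Arguments hj {R}.

Section HypExp.
Variable R : realType.

Definition cosh (x : R) : R := (expR x + expR (- x)) / 2.
Definition sinh (x : R) : R := (expR x - expR (- x)) / 2.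

Definition expj (x : R) : hyperbolic R := (cosh x)%:H + hj * (sinh x)%:H.

End HypExp.

Section DeriveOn.
Variables (R : realType) (I : set R).

Definition diff_quot (f : R -> R) (t s : R) : R := (s - t)^-1 * (f s - f t).

(* Derivative relative to I: two-sided at interior points of I, one-sided at
   the endpoints that belong to I.  Only the values of f on I matter at t in I,
   also for the iterates. *)
Definition derive_on (f : R -> R) (t : R) : R :=
  lim (diff_quot f t @ within I t^').

Definition derivable_on (f : R -> R) (t : R) : Prop :=
  cvg (diff_quot f t @ within I t^').

Definition smooth_on (f : R -> R) : Prop :=
  forall (n : nat) (t : R), I t -> derivable_on (iter n derive_on f) t.

Definition hsmooth_on (w : R -> hyperbolic R) : Prop :=
  smooth_on (fun t => hre (w t)) /\ smooth_on (fun t => him (w t)).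

Definition hderive_on (w : R -> hyperbolic R) (t : R) : hyperbolic R :=
  Hyp (derive_on (fun s => hre (w s)) t) (derive_on (fun s => him (w s)) t).

Lemma derive_on_interior (f : R -> R) (t : R) :
  nbhs t I -> derive_on f t = derive1 f t.
Proof.
move=> It; rewrite /derive_on /derive1.
have -> : within I t^' = t^'.
  apply/seteqP; split => A nA.
    by apply: filterS2 It nA => s Is nAs st; exact: nAs.
  by apply: filterS nA => s As _.
congr (lim _); apply/seteqP; split => A /=;
  rewrite /fmap /= /dnbhs /within /=.
- move=> /nbhs_ballP[e /= e0 eA]; apply/nbhs_ballP; exists e => //= h.
  rewrite /ball /= sub0r normrN => he h0.
  have := eA (h + t); rewrite /diff_quot /ball /= addrK; apply.
    by rewrite opprD addrCA subrr addr0 normrN.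
  by rewrite -subr_eq0 addrK.
- move=> /nbhs_ballP[e /= e0 eA]; apply/nbhs_ballP; exists e => //= s.
  rewrite /ball /= => se st.
  have := eA (s - t); rewrite /diff_quot /ball /= subrK; apply.
    by rewrite sub0r opprB.
  by rewrite subr_eq0.
Qed.

End DeriveOn.

(* A point represented by x in the moving plane is represented by
   ((hscale t)%:H * x - htransl t) * expj (hangle t) in the fixed plane at time
   t (motion_at below).  Only values at t in hdom are meaningful. *)
Record homothetic_motion (R : realType) : Type := HomotheticMotion {
  hdom : interval R;
  hscale : R -> R;
  hangle : R -> R;
  htransl : R -> hyperbolic R;
  hdom0 : 0 \in hdom;
  hscale_smooth : smooth_on [set` hdom] hscale;
  hangle_smooth : smooth_on [set` hdom] hangle;
  htransl_smooth : hsmooth_on [set` hdom] htransl;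
  hscale_nonconstant :
    exists s t, [/\ s \in hdom, t \in hdom & hscale s <> hscale t];
  hangle_regular : forall t, t \in hdom -> derive_on [set` hdom] hangle t <> 0;
  (* The two frames coincide at time 0: same origin, same axes.  The scale at
     time 0 is left unconstrained. *)
  htransl0 : htransl 0 = 0;
  hangle0 : hangle 0 = 0
}.

Section Motion.
Variables (R : realType) (M : homothetic_motion R).

Let I : set R := [set` hdom M].
Let h := hscale M.
Let phi := hangle M.
Let u := htransl M.

Definition dot_hscale : R -> R := derive_on I h.
Definition ddot_hscale : R -> R := derive_on I dot_hscale.
Definition dot_hangle : R -> R := derive_on I phi.
Definition ddot_hangle : R -> R := derive_on I dot_hangle.
Definition dot_htransl : R -> hyperbolic R := hderive_on I u.

Definition motion_at (t : R) (x : hyperbolic R) : hyperbolic R :=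
  ((h t)%:H * x - u t) * expj (phi t).

Definition pole (t : R) : hyperbolic R :=
  (dot_htransl t + hj * (dot_hangle t)%:H * u t)
    / ((dot_hscale t)%:H + hj * (h t * dot_hangle t)%:H).

Definition dot_pole : R -> hyperbolic R := hderive_on I pole.

Definition sliding_acceleration (t : R) (x : hyperbolic R) : hyperbolic R :=
  (x - pole t)
    * ((ddot_hscale t + h t * dot_hangle t ^+ 2)%:H
       + hj * (2 * dot_hscale t * dot_hangle t + h t * ddot_hangle t)%:H)
    * expj (phi t)
  - dot_pole t * ((dot_hscale t)%:H + hj * (h t * dot_hangle t)%:H) * expj (phi t).

Definition is_acceleration_pole (t : R) (x : hyperbolic R) : Prop :=
  sliding_acceleration t x = 0.

End Motion.

(* Main.v *)
Require Import Defs.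
From mathcomp Require Import all_boot all_order all_algebra.
From mathcomp Require Import ring.
From mathcomp Require Import all_classical all_reals all_analysis.
Import Order.TTheory GRing.Theory Num.Theory.
Import numFieldNormedType.Exports.
Local Open Scope ring_scope.

(** After factoring out [expj], the sliding acceleration is [((x - p) * D - c) * expj phi], affine
    in [x]. The hyperbolic numbers have zero divisors, so solving for [x] requires [D] and the
    exponential to be units, not just nonzero. [hplus] and [hminus] keep [D] off both null lines
    ([hyp_unit]); [expj_unit] handles the exponential. Hence vanishing means [(x - p) * D = c], with
    a unique solution. *)

Lemma hyp_unit {F : fieldType} {a b : F} :
  a <> b -> a <> - b -> a%:H + hj * b%:H \is a GRing.unit.
Proof.
move=> ab aNb; rewrite -hypE; apply/negP => /=.
by rewrite eqf_sqr => /orP[] /eqP.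
Qed.

(** In null coordinates [cosh x - sinh x] and [cosh x + sinh x] are the real exponentials of [- x]
    and [x], both positive, so neither null line is met. *)
Lemma expj_unit {R : realType} (x : R) : expj x \is a GRing.unit.
Proof.
have ch_sh : cosh x - sinh x = expR (- x) by rewrite /cosh /sinh; field.
have chDsh : cosh x + sinh x = expR x by rewrite /cosh /sinh; field.
apply: hyp_unit => /eqP.
  by rewrite -subr_eq0 ch_sh gt_eqF ?expR_gt0.
by rewrite -addr_eq0 chDsh gt_eqF ?expR_gt0.
Qed.

Theorem theorem3 (R : realType) (M : homothetic_motion R)
  (hreg : forall t, t \in hdom M ->
     dot_hscale M t ^+ 2 - hscale M t ^+ 2 * dot_hangle M t ^+ 2 <> 0)
  (t : R) (ht : t \in hdom M)
  (hminus : ddot_hscale M t + hscale M t * dot_hangle M t ^+ 2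
            <> - (2 * dot_hscale M t * dot_hangle M t + hscale M t * ddot_hangle M t))
  (hplus : ddot_hscale M t + hscale M t * dot_hangle M t ^+ 2
            <> 2 * dot_hscale M t * dot_hangle M t + hscale M t * ddot_hangle M t)
  (q : hyperbolic R) :
  is_acceleration_pole M t q <->
  q = pole M t
      + dot_pole M t * ((dot_hscale M t)%:H + hj * (hscale M t * dot_hangle M t)%:H)
        / ((ddot_hscale M t + hscale M t * dot_hangle M t ^+ 2)%:H
           + hj * (2 * dot_hscale M t * dot_hangle M t + hscale M t * ddot_hangle M t)%:H).
Proof.
rewrite /is_acceleration_pole /sliding_acceleration -mulrBl.
have Ue := expj_unit (hangle M t); have Ud := hyp_unit hplus hminus.
split=> [/eqP | ->]; last by rewrite (addrC (pole M t)) addrK divrK // subrr mul0r.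
(* A zero product alone does not force a zero factor here; the unit [expj] is regular, so it
   cancels. *)
rewrite mulIr_eq0; last exact: mulIr.
by rewrite subr_eq0 => /eqP <-; rewrite mulrK // addrC subrK.
Qed.
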